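(* Let $R$ be a commutative ring and $s\in R$ an element. (a) Any $s$-separated $s$-complete $R$-module is an $s$-contramodule. (b) Any $s$-torsion-free $s$-contramodule $R$-module is $s$-separated (and $s$-complete).
   Context: An $R$-module $C$ is $s$-complete if the natural map $C\to\varprojlim_{n\ge1}C/s^nC$ is surjective, and $s$-separated if this map is injective. $C$ is $s$-torsion-free if the multiplication map $s\colon C\to C$ is injective. $C$ is an $s$-contramodule if $\operatorname{Hom}_R(R[s^{-1}],C)=0=\operatorname{Ext}^1_R(R[s^{-1}],C)$, where $R[s^{-1}]$ is the localization of $R$ at $\{1,s,s^2,\dots\}$. *)

(* Defs.v *)
From HB Require Import structures.
From mathcomp Require Import all_boot all_order all_algebra.
From mathcomp Require Import finmap all_classical.
From mathcomp Require Import ring.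

Set Implicit Arguments.
Unset Strict Implicit.
Unset Printing Implicit Defensive.

Import GRing.Theory.

Local Open Scope ring_scope.
Local Open Scope quotient_scope.

(* Rings are comPzRingType: a commutative ring with 1, the zero ring allowed. *)

Definition spow_sub (R : comPzRingType) (s : R) (C : lmodType R) (n : nat) :
  {pred C} := [pred x : C | `[< exists c : C, x = s ^+ n *: c >]].
Arguments spow_sub {R} s C n.

Section SpowSub.
Variables (R : comPzRingType) (s : R) (C : lmodType R) (n : nat).

Lemma spow_subP (x : C) :
  reflect (exists c : C, x = s ^+ n *: c) (x \in spow_sub s C n).
Proof. exact: asboolP. Qed.

Lemma spow_sub_zmod_closed : zmod_closed (spow_sub s C n).
Proof.
split; first by apply/spow_subP; exists 0; rewrite scaler0.
move=> x y /spow_subP[c ->] /spow_subP[d ->].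
by apply/spow_subP; exists (c - d); rewrite scalerBr.
Qed.

HB.instance Definition _ :=
  GRing.isZmodClosed.Build C (spow_sub s C n) spow_sub_zmod_closed.

End SpowSub.

Definition spow_quot (R : comPzRingType) (s : R) (C : lmodType R) (n : nat) :=
  Quotient.quot (spow_sub s C n).
Arguments spow_quot {R} s C n.

(* The transition map C/s^n C -> C/s^m C; meaningful for m <= n, see
   spow_trans_pi. *)
Definition spow_trans (R : comPzRingType) (s : R) (C : lmodType R) (m n : nat)
    (x : spow_quot s C n) : spow_quot s C m :=
  \pi_(spow_quot s C m) (repr x).

Lemma spow_quotP (R : comPzRingType) (s : R) (C : lmodType R) n (x y : C) :
  reflect (exists c : C, x - y = s ^+ n *: c)
    (\pi_(spow_quot s C n) x == \pi_(spow_quot s C n) y).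
Proof. by rewrite -Quotient.idealrBE; apply: spow_subP. Qed.

Lemma spow_trans_pi (R : comPzRingType) (s : R) (C : lmodType R) m n (c : C) :
  (m <= n)%N ->
  spow_trans m (\pi_(spow_quot s C n) c) = \pi_(spow_quot s C m) c.
Proof.
move=> lemn; apply/eqP/spow_quotP.
have /spow_quotP[d ->] : \pi_(spow_quot s C n) (repr (\pi_(spow_quot s C n) c))
    == \pi_(spow_quot s C n) c by rewrite reprK.
by exists (s ^+ (n - m) *: d); rewrite scalerA -exprD subnKC.
Qed.

(* Index i stands for the exponent n = i.+1 >= 1. *)
Definition spow_lim (R : comPzRingType) (s : R) (C : lmodType R) : Type :=
  {x : forall i : nat, spow_quot s C i.+1 |
    forall i j : nat, (i <= j)%N -> spow_trans i.+1 (x j) = x i}.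

Lemma to_spow_lim_compat (R : comPzRingType) (s : R) (C : lmodType R) (c : C)
    (i j : nat) :
  (i <= j)%N ->
  spow_trans i.+1 (\pi_(spow_quot s C j.+1) c) = \pi_(spow_quot s C i.+1) c.
Proof. by move=> leij; exact: spow_trans_pi. Qed.

Definition to_spow_lim (R : comPzRingType) (s : R) (C : lmodType R) (c : C) :
    spow_lim s C :=
  exist _ (fun i => \pi_(spow_quot s C i.+1) c) (to_spow_lim_compat s c).

Definition s_complete (R : comPzRingType) (s : R) (C : lmodType R) : Prop :=
  forall y : spow_lim s C, exists c : C, to_spow_lim s c = y.

Definition s_separated (R : comPzRingType) (s : R) (C : lmodType R) : Prop :=
  injective (@to_spow_lim R s C).

Definition s_torsion_free (R : comPzRingType) (s : R) (C : lmodType R) : Prop :=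
  injective (fun c : C => s *: c).

(* R[s^-1]: the pair (a, n) stands for the fraction a / s^n. *)
Section Localization.
Variables (R : comPzRingType) (s : R).

Definition loc_rel (x y : R * nat) : bool :=
  `[< exists k : nat, s ^+ k * (s ^+ y.2 * x.1 - s ^+ x.2 * y.1) = 0 >].

Lemma loc_relP x y : reflect
  (exists k : nat, s ^+ k * (s ^+ y.2 * x.1 - s ^+ x.2 * y.1) = 0)
  (loc_rel x y).
Proof. exact: asboolP. Qed.

Lemma loc_rel_refl : reflexive loc_rel.
Proof. by move=> x; apply/loc_relP; exists 0%N; rewrite subrr mulr0. Qed.

Lemma loc_rel_sym : symmetric loc_rel.
Proof.
suff sub x y : loc_rel x y -> loc_rel y x by move=> x y; apply/idP/idP; exact: sub.
case/loc_relP=> k e; apply/loc_relP; exists k.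
by rewrite -opprB mulrN e oppr0.
Qed.

Lemma loc_rel_trans : transitive loc_rel.
Proof.
move=> [b n] [a m] [c p] /loc_relP[k /= ek] /loc_relP[l /= el].
apply/loc_relP; exists (k + l + n)%N => /=; rewrite !exprD.
have -> : s ^+ k * s ^+ l * s ^+ n * (s ^+ p * a - s ^+ m * c) =
  s ^+ l * s ^+ p * (s ^+ k * (s ^+ n * a - s ^+ m * b)) +
  s ^+ k * s ^+ m * (s ^+ l * (s ^+ p * b - s ^+ n * c)) by ring.
by rewrite ek el !mulr0 addr0.
Qed.

Canonical loc_equiv :=
  EquivRel loc_rel loc_rel_refl loc_rel_sym loc_rel_trans.

Definition loc : Type := {eq_quot loc_rel}.

HB.instance Definition _ := Choice.on loc.

Definition loc_frac (a : R) (n : nat) : loc := \pi_{eq_quot loc_rel} (a, n).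

Lemma loc_fracP a m b n : reflect
  (exists k : nat, s ^+ k * (s ^+ n * a - s ^+ m * b) = 0)
  (loc_frac a m == loc_frac b n).
Proof. by rewrite [_ == _]eqmodE; exact: (loc_relP (a, m) (b, n)). Qed.

Lemma loc_fracE (x : loc) : exists a n, x = loc_frac a n.
Proof.
by exists (repr (x : {eq_quot loc_rel})).1, (repr (x : {eq_quot loc_rel})).2;
  rewrite /loc_frac -surjective_pairing reprK.
Qed.

Definition loc_lift T (f : R -> nat -> T) (x : loc) : T :=
  f (repr (x : {eq_quot loc_rel})).1 (repr (x : {eq_quot loc_rel})).2.

Lemma loc_liftE T (f : R -> nat -> T) a n :
  (forall a m b n k, s ^+ k * (s ^+ n * a - s ^+ m * b) = 0 ->
    f a m = f b n) ->
  loc_lift f (loc_frac a n) = f a n.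
Proof.
move=> H; rewrite /loc_lift; set y := repr _.
have : loc_frac y.1 y.2 == loc_frac a n.
  by rewrite /loc_frac -surjective_pairing /y reprK.
by case/loc_fracP=> k /H.
Qed.

Definition loc_zero : loc := loc_frac 0 0.
Definition loc_one : loc := loc_frac 1 0.
Definition loc_opp : loc -> loc := loc_lift (fun a m => loc_frac (- a) m).
Definition loc_add (x y : loc) : loc :=
  loc_lift (fun a m => loc_lift (fun b n =>
    loc_frac (s ^+ n * a + s ^+ m * b) (m + n)) y) x.
Definition loc_mul (x y : loc) : loc :=
  loc_lift (fun a m => loc_lift (fun b n => loc_frac (a * b) (m + n)) y) x.

Lemma loc_oppE a m : loc_opp (loc_frac a m) = loc_frac (- a) m.
Proof.
apply: loc_liftE => {}a {}m b n k e; apply/eqP/loc_fracP; exists k.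
by rewrite !mulrN -opprD mulrN e oppr0.
Qed.

Lemma loc_addE a m b n : loc_add (loc_frac a m) (loc_frac b n) =
  loc_frac (s ^+ n * a + s ^+ m * b) (m + n).
Proof.
have H x p : loc_lift (fun b n => loc_frac (s ^+ n * x + s ^+ p * b) (p + n))
    (loc_frac b n) = loc_frac (s ^+ n * x + s ^+ p * b) (p + n).
  apply: loc_liftE => {}a {}m {}b {}n k e; apply/eqP/loc_fracP; exists k.
  rewrite !exprD.
  transitivity (s ^+ p * s ^+ p * (s ^+ k * (s ^+ n * a - s ^+ m * b))).
    by ring.
  by rewrite e mulr0.
rewrite /loc_add loc_liftE ?H // => {}a {}m c p k e; rewrite !H.
apply/eqP/loc_fracP; exists k; rewrite !exprD.
transitivity (s ^+ n * s ^+ n * (s ^+ k * (s ^+ p * a - s ^+ m * c))).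
  by ring.
by rewrite e mulr0.
Qed.

Lemma loc_mulE a m b n :
  loc_mul (loc_frac a m) (loc_frac b n) = loc_frac (a * b) (m + n).
Proof.
have H x p : loc_lift (fun b n => loc_frac (x * b) (p + n))
    (loc_frac b n) = loc_frac (x * b) (p + n).
  apply: loc_liftE => {}a {}m {}b {}n k e; apply/eqP/loc_fracP; exists k.
  rewrite !exprD.
  transitivity (s ^+ p * x * (s ^+ k * (s ^+ n * a - s ^+ m * b))); first by ring.
  by rewrite e mulr0.
rewrite /loc_mul loc_liftE ?H // => {}a {}m c p k e; rewrite !H.
apply/eqP/loc_fracP; exists k; rewrite !exprD.
transitivity (s ^+ n * b * (s ^+ k * (s ^+ p * a - s ^+ m * c))); first by ring.
by rewrite e mulr0.
Qed.

Lemma loc_frac_eq a m b n : s ^+ n * a = s ^+ m * b -> loc_frac a m = loc_frac b n.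
Proof.
by move=> e; apply/eqP/loc_fracP; exists 0%N; rewrite e subrr mulr0.
Qed.

Lemma loc_addA : associative loc_add.
Proof.
move=> x y z; have [a [m ->]] := loc_fracE x; have [b [n ->]] := loc_fracE y.
have [c [p ->]] := loc_fracE z.
by rewrite !loc_addE; apply: loc_frac_eq; rewrite !exprD; ring.
Qed.

Lemma loc_addC : commutative loc_add.
Proof.
move=> x y; have [a [m ->]] := loc_fracE x; have [b [n ->]] := loc_fracE y.
by rewrite !loc_addE; apply: loc_frac_eq; rewrite !exprD; ring.
Qed.

Lemma loc_add0 : left_id loc_zero loc_add.
Proof.
move=> x; have [a [m ->]] := loc_fracE x.
by rewrite !loc_addE; apply: loc_frac_eq; rewrite !exprD expr0; ring.
Qed.

Lemma loc_addN : left_inverse loc_zero loc_opp loc_add.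
Proof.
move=> x; have [a [m ->]] := loc_fracE x.
by rewrite loc_oppE !loc_addE; apply: loc_frac_eq; rewrite !exprD; ring.
Qed.

HB.instance Definition _ :=
  GRing.isZmodule.Build loc loc_addA loc_addC loc_add0 loc_addN.

Lemma loc_mulA : associative loc_mul.
Proof.
move=> x y z; have [a [m ->]] := loc_fracE x; have [b [n ->]] := loc_fracE y.
have [c [p ->]] := loc_fracE z.
by rewrite !loc_mulE; apply: loc_frac_eq; rewrite !exprD; ring.
Qed.

Lemma loc_mulC : commutative loc_mul.
Proof.
move=> x y; have [a [m ->]] := loc_fracE x; have [b [n ->]] := loc_fracE y.
by rewrite !loc_mulE; apply: loc_frac_eq; rewrite !exprD; ring.
Qed.

Lemma loc_mul1 : left_id loc_one loc_mul.
Proof.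
move=> x; have [a [m ->]] := loc_fracE x.
by rewrite !loc_mulE; apply: loc_frac_eq; rewrite !exprD expr0; ring.
Qed.

Lemma loc_mulDl : left_distributive loc_mul loc_add.
Proof.
move=> x y z; have [a [m ->]] := loc_fracE x; have [b [n ->]] := loc_fracE y.
have [c [p ->]] := loc_fracE z.
by rewrite !(loc_mulE, loc_addE); apply: loc_frac_eq; rewrite !exprD; ring.
Qed.

HB.instance Definition _ := GRing.Zmodule_isComPzRing.Build loc
  loc_mulA loc_mulC loc_mul1 loc_mulDl.

Definition loc_scale (r : R) (x : loc) : loc := loc_frac r 0 * x.

Lemma loc_scaleE r a m : loc_scale r (loc_frac a m) = loc_frac (r * a) m.
Proof. exact: loc_mulE. Qed.

Lemma loc_scaleA a b x : loc_scale a (loc_scale b x) = loc_scale (a * b) x.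
Proof. by rewrite /loc_scale mulrA; congr (_ * _); exact: loc_mulE. Qed.

Lemma loc_scale1 : left_id 1 loc_scale.
Proof. exact: loc_mul1. Qed.

Lemma loc_scaleDr : right_distributive loc_scale +%R.
Proof. by move=> r x y; exact: mulrDr. Qed.

Lemma loc_scaleDl x : {morph loc_scale^~ x : a b / a + b}.
Proof.
move=> a b; have [c [m ->]] := loc_fracE x; rewrite !loc_scaleE.
rewrite [RHS]loc_addE; apply: loc_frac_eq; rewrite !exprD; ring.
Qed.

HB.instance Definition _ := GRing.Zmodule_isLmodule.Build R loc
  loc_scaleA loc_scale1 loc_scaleDr loc_scaleDl.

End Localization.

Definition projective (R : comPzRingType) (P : lmodType R) : Prop :=
  forall (A B : lmodType R) (p : {linear A -> B}) (f : {linear P -> B}),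
    (forall b : B, exists a : A, p a = b) ->
    exists g : {linear P -> A}, forall x : P, p (g x) = f x.

(* ... -> P_2 -> P_1 -> P_0 -> M -> 0, with res_d n : P_(n+1) -> P_n. *)
Record projective_resolution (R : comPzRingType) (M : lmodType R) := {
  res_obj : nat -> lmodType R;
  res_d : forall n : nat, {linear res_obj n.+1 -> res_obj n};
  res_aug : {linear res_obj 0%N -> M};
  res_projective : forall n : nat, projective (res_obj n);
  res_aug_surj : forall m : M, exists x : res_obj 0%N, res_aug x = m;
  res_exact0 : forall x : res_obj 0%N,
    res_aug x = 0 <-> exists y, res_d 0 y = x;
  res_exact : forall (n : nat) (x : res_obj n.+1),
    res_d n x = 0 <-> exists y, res_d n.+1 y = x
}.

Definition hom_eq0 (R : comPzRingType) (M N : lmodType R) : Prop :=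
  forall (f : {linear M -> N}) (x : M), f x = 0.

(* H^1 of the cochain complex n |-> Hom_R(P_n, N) vanishes. *)
Definition res_H1_eq0 (R : comPzRingType) (M N : lmodType R)
    (P : projective_resolution M) : Prop :=
  forall f : {linear res_obj P 1 -> N},
    (forall x, f (res_d P 1 x) = 0) ->
    exists g : {linear res_obj P 0 -> N}, forall x, g (res_d P 0 x) = f x.

(* Ext^1_R(M, N) = 0.  Resolutions exist (projective_resolution_exists) and the
   choice is immaterial (res_H1_eq0_indep). *)
Definition Ext1_eq0 (R : comPzRingType) (M N : lmodType R) : Prop :=
  forall P : projective_resolution M, res_H1_eq0 N P.

Definition s_contramodule (R : comPzRingType) (s : R) (C : lmodType R) : Prop :=
  hom_eq0 (loc s) C /\ Ext1_eq0 (loc s) C.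

(* The free module on X: finitely supported functions X -> R. *)
Section Free.
Variables (R : comPzRingType) (X : choiceType).

Definition fin_supp : {pred X -> R^o} :=
  [pred f : X -> R^o | `[< finite_set [set x | f x <> 0]%classic >]].

Lemma fin_suppP (f : X -> R^o) :
  reflect (exists A : {fset X}, forall x, x \notin A -> f x = 0)
    (f \in fin_supp).
Proof.
apply: (iffP (asboolP _)) => [fin_f|[A fA]].
  exists (fset_set [set x | f x <> 0]%classic) => x.
  by rewrite in_fset_set// notin_setE /= => /contrapT.
apply: (sub_finite_set _ (finite_fset A)) => x /= fx0.
by apply: contrapT => /negP xA; apply: fx0; exact: fA.
Qed.

Lemma fin_supp_submod_closed : submod_closed fin_supp.
Proof.
split; first by apply/fin_suppP; exists fset0.
move=> a f g /fin_suppP[A fA] /fin_suppP[B gB]; apply/fin_suppP.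
exists (A `|` B)%fset => x; rewrite in_fsetU negb_or => /andP[xA xB].
by rewrite -[LHS]/(a *: f x + g x) fA // gB // scaler0 addr0.
Qed.

HB.instance Definition _ :=
  GRing.isSubmodClosed.Build R (X -> R^o) fin_supp fin_supp_submod_closed.

Record freemod := Free { free_val :> X -> R^o; _ : free_val \in fin_supp }.

HB.instance Definition _ := [isSub for free_val].
HB.instance Definition _ := [Choice of freemod by <:].
HB.instance Definition _ := [SubChoice_isSubLmodule of freemod by <:].

Lemma free_supp (f : freemod) : exists A : {fset X}, forall x, x \notin A -> f x = 0.
Proof. by apply/fin_suppP; case: f. Qed.

Lemma free_gen_proof (x : X) : (fun y => (x == y)%:R) \in fin_supp.
Proof.
apply/fin_suppP; exists [fset x]%fset => y; rewrite in_fset1.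
by rewrite eq_sym => /negbTE ->.
Qed.

Definition free_gen (x : X) : freemod := Free (free_gen_proof x).

Section Lift.
Variables (M : lmodType R) (h : X -> M).

Definition free_lift (f : freemod) : M := \sum_(x \in [set: X]) (f x *: h x).

Lemma free_liftE (f : freemod) (A : {fset X}) :
  (forall x, x \notin A -> f x = 0) -> free_lift f = \sum_(x <- A) f x *: h x.
Proof. by move=> fA; apply: fsbigTE => x /fA ->; rewrite scale0r. Qed.

Lemma free_lift_is_linear : linear free_lift.
Proof.
move=> a f g; have [A fA] := free_supp f; have [B gB] := free_supp g.
have fAB x : x \notin (A `|` B)%fset -> f x = 0.
  by rewrite in_fsetU negb_or => /andP[/fA].
have gAB x : x \notin (A `|` B)%fset -> g x = 0.
  by rewrite in_fsetU negb_or => /andP[_ /gB].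
rewrite (free_liftE fAB) (free_liftE gAB) (@free_liftE _ (A `|` B)%fset); last first.
  by move=> x xAB; rewrite -[LHS]/(a *: f x + g x) fAB // gAB // scaler0 addr0.
rewrite scaler_sumr -big_split /=; apply: eq_bigr => x _.
by rewrite -[X in X *: _]/(a * f x + g x) scalerDl scalerA.
Qed.

HB.instance Definition _ :=
  GRing.isLinear.Build R freemod M *:%R free_lift free_lift_is_linear.

Lemma free_lift_gen x : free_lift (free_gen x) = h x.
Proof.
rewrite (@free_liftE _ [fset x]%fset) ?big_seq_fset1 /= ?eqxx ?scale1r //.
by move=> y; rewrite in_fset1 /= eq_sym => /negbTE ->.
Qed.

End Lift.

Lemma free_decomp (f : freemod) : free_lift free_gen f = f.
Proof.
have [A fA] := free_supp f; rewrite (free_liftE _ fA).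
apply/val_inj/funext => y.
rewrite (raddf_sum (val : freemod -> (X -> R^o))) fct_sumE /=.
rewrite (eq_bigr (fun x => if x == y then f x else 0)); last first.
  move=> x _; rewrite -[LHS]/(f x * (x == y)%:R).
  by case: eqP => _; rewrite ?mulr1 ?mulr0.
case: (boolP (y \in A)) => yA.
  rewrite (big_fsetD1 y) //= eqxx big_seq big1 ?addr0 // => x.
  by rewrite in_fsetD1 => /andP[/negbTE ->].
rewrite fA // big_seq big1 // => x xA.
by case: eqP => // xy; rewrite -xy xA in yA.
Qed.

Lemma free_linear_ext (M : lmodType R) (u v : {linear freemod -> M}) :
  (forall x, u (free_gen x) = v (free_gen x)) -> u =1 v.
Proof.
move=> uv f; rewrite -(free_decomp f); have [A fA] := free_supp f.
rewrite (free_liftE _ fA) !linear_sum; apply: eq_bigr => x _.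
by rewrite !linearZ /= uv.
Qed.

Lemma free_projective : projective freemod.
Proof.
move=> A B p f p_surj.
have [h hP] : exists h : X -> A, forall x, p (h x) = f (free_gen x).
  by exists (fun x => projT1 (cid (p_surj (f (free_gen x))))) => x; case: cid.
exists (free_lift h) => x.
apply: (free_linear_ext (u := p \o free_lift h)) => y.
by rewrite /= free_lift_gen hP.
Qed.

End Free.

Section FreeResolution.
Variables (R : comPzRingType) (M : lmodType R).

Record arrow := Arrow
  { asrc : lmodType R; atgt : lmodType R; amap : {linear asrc -> atgt} }.

Definition arrow_next (a : arrow) : arrow :=
  Arrow (free_lift (val : {x : asrc a | amap a x == 0} -> asrc a)).

Definition arrow_iter (n : nat) : arrow :=
  iter n arrow_next (Arrow (free_lift (idfun : M -> M))).

Lemma arrow_next_exact (a : arrow) (x : asrc a) :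
  amap a x = 0 <-> exists y, amap (arrow_next a) y = x.
Proof.
split=> [/eqP ax|[y <-]].
  exists (free_gen R (exist _ x ax : {x : asrc a | amap a x == 0})).
  exact: free_lift_gen.
have [A yA] := free_supp y; rewrite /= (free_liftE _ yA) linear_sum big1 // => z _.
by rewrite linearZ /= (eqP (valP z)) scaler0.
Qed.

Lemma projective_resolution_exists : inhabited (projective_resolution M).
Proof.
constructor; unshelve econstructor.
- exact: (fun n => asrc (arrow_iter n)).
- exact: (fun n => amap (arrow_iter n.+1)).
- exact: (amap (arrow_iter 0)).
- by case=> [|n]; exact: free_projective.
- by move=> m; exists (free_gen R m); exact: free_lift_gen.
- by move=> x; exact: (@arrow_next_exact (arrow_iter 0)).
- by move=> n x; exact: (@arrow_next_exact (arrow_iter n.+1)).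
Qed.

End FreeResolution.

Section Kernel.
Variables (R : comPzRingType) (B A : lmodType R) (p : {linear B -> A}).

Definition ker_pred : {pred B} := [pred x | p x == 0].

Lemma ker_submod_closed : submod_closed ker_pred.
Proof.
split; first by rewrite inE linear0.
by move=> a x y; rewrite !inE linearP => /eqP -> /eqP ->; rewrite scaler0 addr0.
Qed.

HB.instance Definition _ :=
  GRing.isSubmodClosed.Build R B ker_pred ker_submod_closed.

Record ker := Ker { ker_val : B; _ : ker_val \in ker_pred }.

HB.instance Definition _ := [isSub for ker_val].
HB.instance Definition _ := [Choice of ker by <:].
HB.instance Definition _ := [SubChoice_isSubLmodule of ker by <:].

Section Factor.
Variables (C : lmodType R) (f : {linear C -> B}) (pf0 : forall x, p (f x) = 0).

Lemma ker_factor_proof x : f x \in ker_pred.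
Proof. by rewrite inE pf0. Qed.

Definition ker_factor (x : C) : ker := Ker (ker_factor_proof x).

Lemma ker_factor_is_linear : linear ker_factor.
Proof. by move=> a x y; apply: val_inj; rewrite /= linearP. Qed.

HB.instance Definition _ :=
  GRing.isLinear.Build R C ker *:%R ker_factor ker_factor_is_linear.

End Factor.
End Kernel.

Section Comparison.
Variables (R : comPzRingType) (M N : lmodType R).

Lemma projective_lift (P A B C : lmodType R) (p : {linear B -> A})
    (q : {linear C -> B}) (f : {linear P -> B}) :
  projective P -> (forall x, p x = 0 <-> exists y, q y = x) ->
  (forall x, p (f x) = 0) ->
  exists g : {linear P -> C}, forall x, q (g x) = f x.
Proof.
move=> projP ex pf0.
have pq0 x : p (q x) = 0 by apply/ex; exists x.
have [|g gP] := projP _ _ (ker_factor pq0) (ker_factor pf0).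
  move=> [b pb]; have /eqP/ex[c qc] : p b == 0 by move: pb; rewrite inE.
  by exists c; apply: val_inj.
by exists g => x; have /(congr1 val) := gP x.
Qed.

Lemma res_compare (P Q : projective_resolution M) :
  exists (u0 : {linear res_obj P 0 -> res_obj Q 0})
         (u1 : {linear res_obj P 1 -> res_obj Q 1})
         (u2 : {linear res_obj P 2 -> res_obj Q 2}),
    [/\ forall x, res_aug Q (u0 x) = res_aug P x,
        forall x, res_d Q 0 (u1 x) = u0 (res_d P 0 x) &
        forall x, res_d Q 1 (u2 x) = u1 (res_d P 1 x)].
Proof.
have dP0 x : res_aug P (res_d P 0 x) = 0 by apply/res_exact0; exists x.
have dP1 x : res_d P 0 (res_d P 1 x) = 0 by apply/res_exact; exists x.
have [u0 u0P] := res_projective (res_aug P) (@res_aug_surj _ _ Q).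
have [|u1 u1P] := projective_lift (f := u0 \o res_d P 0)
    (@res_projective _ _ P 1) (@res_exact0 _ _ Q).
  by move=> x /=; rewrite u0P.
have [|u2 u2P] := projective_lift (f := u1 \o res_d P 1)
    (@res_projective _ _ P 2) (@res_exact _ _ Q 0).
  by move=> x /=; rewrite u1P /= dP1 linear0.
by exists u0, u1, u2.
Qed.

Lemma res_H1_eq0_indep (P Q : projective_resolution M) :
  res_H1_eq0 N Q -> res_H1_eq0 N P.
Proof.
move=> HQ f fd0.
have [u0 [u1 [_ [u0P u1P _]]]] := res_compare P Q.
have [v0 [v1 [v2 [v0P v1P v2P]]]] := res_compare Q P.
have [|g gP] := HQ (f \o v1); first by move=> x /=; rewrite -v2P fd0.
have [|h0 h0P] := projective_lift (f := idfun \- (v0 \o u0))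
    (@res_projective _ _ P 0) (@res_exact0 _ _ P).
  by move=> x /=; rewrite linearB /= v0P u0P subrr.
have [|h1 h1P] := projective_lift
    (f := idfun \- (v1 \o u1) \- (h0 \o res_d P 0))
    (@res_projective _ _ P 1) (@res_exact _ _ P 0).
  by move=> x /=; rewrite !linearB /= v1P u1P h0P /= subrr.
exists ((g \o u0) \+ (f \o h0)) => x /=.
have := fd0 (h1 x); rewrite h1P /= !linearB /= -u1P gP /= => /eqP.
by rewrite -addrA -opprD subr_eq0 => /eqP <-.
Qed.

End Comparison.

(* Main.v *)
From HB Require Import structures.
Require Import Defs.
From mathcomp Require Import all_boot all_order all_algebra.
From mathcomp Require Import finmap all_classical ring.

(** [R[s^-1]] is the colimit of the telescope [R -s-> R -s-> ...], which gives
    the free resolution [0 -> R^(N) -> R^(N) -> R[s^-1] -> 0] sending [e_n] to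
    [e_n - s e_(n+1)].  Hence [Ext^1(R[s^-1], C) = 0] iff every system
    [b_n - s b_(n+1) = a_n] is solvable in [C].  In the separated complete case
    the solution is the convergent sum [b_n = \sum_k s^k a_(n+k)].  Conversely,
    if [x_(i+1) - x_i = s^(i+1) a_i] represents an element of the limit, then
    [x_0 + s b_0] maps to it; and in the torsion-free case an infinitely
    [s]-divisible [d] yields the morphism [a / s^n |-> a (d / s^n)] out of
    [R[s^-1]], so [d = 0]. *)

Set Implicit Arguments.
Unset Strict Implicit.
Unset Printing Implicit Defensive.

Import GRing.Theory.

Local Open Scope ring_scope.
Local Open Scope quotient_scope.

(** * The telescope resolution of [R[s^-1]] and the resulting criterion for [Ext^1] *)

Section Telescope.
Variables (R : comPzRingType) (s : R).

Definition tele_d : freemod R nat -> freemod R nat :=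
  free_lift (fun n => free_gen R n - s *: free_gen R n.+1).
HB.instance Definition _ := GRing.Linear.on tele_d.

Definition tele_aug : freemod R nat -> loc s :=
  free_lift (fun n => loc_frac s 1 n).
HB.instance Definition _ := GRing.Linear.on tele_aug.

Lemma tele_d_gen n :
  tele_d (free_gen R n) = free_gen R n - s *: free_gen R n.+1.
Proof. exact: free_lift_gen. Qed.

Lemma tele_dZ a x : tele_d (a *: x) = a *: tele_d x.
Proof. exact: linearZ. Qed.

Lemma tele_aug_gen n : tele_aug (free_gen R n) = loc_frac s 1 n.
Proof. exact: free_lift_gen. Qed.

Lemma scale_loc_frac r a n : r *: loc_frac s a n = loc_frac s (r * a) n.
Proof. exact: loc_scaleE. Qed.

Lemma tele_aug_d x : tele_aug (tele_d x) = 0.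
Proof.
apply: (free_linear_ext (u := tele_aug \o tele_d) (v := \0)) => n /=.
rewrite tele_d_gen linearB linearZ /= !tele_aug_gen scale_loc_frac.
apply/eqP; rewrite subr_eq0; apply/eqP/loc_frac_eq.
by rewrite !mulr1 exprSr.
Qed.

Lemma tele_d_coef x n :
  tele_d x n = x n - (if n is m.+1 then s * x m else 0).
Proof.
have h : linear (fun x : freemod R nat =>
    x n - (if n is m.+1 then s * x m else 0) : R^o).
  move=> a y z.
  have E k : (a *: y + z) k = a * y k + z k by [].
  rewrite -[a *: (_ - _)]/(a * (_ - _)).
  by case: n => [|m]; rewrite !E; ring.
have h' : linear (fun x : freemod R nat => tele_d x n : R^o).
  by move=> a y z; rewrite linearP.
pose u : {linear freemod R nat -> R^o} :=
  HB.pack (fun x : freemod R nat => tele_d x n : R^o)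
    (GRing.isLinear.Build _ _ _ _ _ h').
pose v : {linear freemod R nat -> R^o} :=
  HB.pack (fun x : freemod R nat =>
    x n - (if n is m.+1 then s * x m else 0) : R^o)
    (GRing.isLinear.Build _ _ _ _ _ h).
apply: (free_linear_ext (u := u) (v := v)) => k.
rewrite /u /v /= tele_d_gen.
have -> : (free_gen R k - s *: free_gen R k.+1) n =
  (k == n)%:R - s * (k.+1 == n)%:R by [].
by case: n {u v h h'} => [|m] /=; rewrite ?mulr0.
Qed.

(** By [tele_d_coef], a kernel element has [x 0 = 0] and [x m.+1 = s * x m], so its coefficients
    vanish one after another. *)
Lemma tele_d_inj x : tele_d x = 0 -> x = 0.
Proof.
move=> dx0; apply/val_inj/funext => n.
have xE k : x k = if k is m.+1 then s * x m else 0.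
  by apply/eqP; rewrite -subr_eq0 -tele_d_coef dx0.
by elim: n => [|n IH] /=; rewrite xE // -[x n]/(val x n) IH mulr0.
Qed.

(** Telescoping sum of the [s ^+ j *: tele_d e_(n+j)] for [j < k]: modulo the image, a generator can
    be pushed to any later index. *)
Lemma tele_shift (n k : nat) :
  exists y, free_gen R n - s ^+ k *: free_gen R (n + k)%N = tele_d y.
Proof.
elim: k => [|k [y yP]].
  by exists 0; rewrite addn0 scale1r subrr linear0.
exists (y + s ^+ k *: free_gen R (n + k)%N).
rewrite linearD /= tele_dZ tele_d_gen -yP scalerBr scalerA -exprSr addnS.
by rewrite addrA subrK.
Qed.

Lemma tele_top x :
  exists N a y, x = a *: free_gen R N + tele_d y.
Proof.
have [A xA] := free_supp x.
rewrite -(free_decomp x) (free_liftE _ xA).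
elim: (A : seq nat) => [|n S [N [a [y yP]]]].
  by rewrite big_nil; exists 0%N, 0, 0; rewrite scale0r linear0 addr0.
rewrite big_cons yP.
have [y1 e1] := tele_shift n N; have [y2 e2] := tele_shift N n.
(* Both [e_n] and [e_N] are pushed to the common index [n + N], at the cost of [s ^+ N] and
   [s ^+ n]. *)
exists (n + N)%N, (x n * s ^+ N + a * s ^+ n).
exists ((x n : R) *: y1 + a *: y2 + y).
rewrite !linearD /= !tele_dZ -e1 -e2 !scalerBr !scalerA (addnC N n) scalerDl.
by rewrite addrA [RHS]addrA; congr (_ + _); rewrite [RHS]addrC addrACA !subrK.
Qed.

Lemma tele_exact x : tele_aug x = 0 <-> exists y, tele_d y = x.
Proof.
split=> [|[y <-]]; last exact: tele_aug_d.
have [N [a [y ->]]] := tele_top x.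
rewrite linearD linearZ /= tele_aug_d addr0 tele_aug_gen scale_loc_frac mulr1.
(* The fraction [a / s^N] is zero, so some [s ^+ k] kills [a]; pushing [a *: e_N] up by [k] steps
   then leaves only a boundary. *)
move=> /eqP/loc_fracP[k]; rewrite expr0 mul1r mulr0 subr0 => ska.
have [z zP] := tele_shift N k.
exists (a *: z + y); rewrite linearD linearZ /= -zP scalerBr scalerA.
by rewrite (mulrC a) ska scale0r subr0.
Qed.

Lemma tele_aug_surj m : exists x, tele_aug x = m.
Proof.
have [a [n ->]] := loc_fracE m; exists (a *: free_gen R n).
by rewrite linearZ /= tele_aug_gen scale_loc_frac mulr1.
Qed.

Lemma freemod_void (x : freemod R void) : x = 0.
Proof. by apply/val_inj/funext; case. Qed.

(** The zero modules in degrees at least 2 are free on [void], so [free_projective] covers all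
    degrees. *)
Definition tele_obj (n : nat) : lmodType R :=
  if n is n'.+2 then freemod R void else freemod R nat.

Definition tele_diff (n : nat) : {linear tele_obj n.+1 -> tele_obj n} :=
  match n with
  | 0 => tele_d
  | n'.+1 => \0
  end.

Lemma tele_obj_projective n : projective (tele_obj n).
Proof. by case: n => [|[|n]]; exact: free_projective. Qed.

Lemma tele_diff_exact n (x : tele_obj n.+1) :
  tele_diff n x = 0 <-> exists y, tele_diff n.+1 y = x.
Proof.
case: n x => [|n] x; last first.
  by split=> // _; exists 0; rewrite (freemod_void x).
split=> [/tele_d_inj ->|[y <-]]; first by exists 0.
exact: linear0.
Qed.

Definition tele_resolution : projective_resolution (loc s) :=
  Build_projective_resolution tele_obj_projective tele_aug_surj
    (res_d := tele_diff) tele_exact tele_diff_exact.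

(** The resolution vanishes in degree 2, so every map from degree 1 is a cocycle. Such a map is a
    sequence [a], and factoring it through [tele_d] amounts to finding [b]. *)
Lemma Ext1_locP (C : lmodType R) :
  Ext1_eq0 (loc s) C <->
  forall a : nat -> C, exists b : nat -> C, forall n, b n - s *: b n.+1 = a n.
Proof.
split=> [H a|H P].
  have extend (f : {linear freemod R nat -> C}) :
      exists g : {linear freemod R nat -> C}, forall x, g (tele_d x) = f x.
    by apply: (H tele_resolution f) => x; exact: linear0.
  have [g gP] := extend (free_lift a).
  exists (fun n => g (free_gen R n)) => n.
  by rewrite -linearZ -linearB /= -tele_d_gen gP /= free_lift_gen.
apply: (res_H1_eq0_indep (Q := tele_resolution)) => f _.
have [b bP] := H (fun n : nat => f (free_gen R n)).
exists (free_lift b).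
apply: (free_linear_ext (u := free_lift b \o tele_d) (v := f)) => n.
by rewrite /= tele_d_gen linearB linearZ /= !free_lift_gen bP.
Qed.

End Telescope.

(** * Separatedness and completeness in terms of elements, and the two implications *)

Section Contramodule.
Variables (R : comPzRingType) (s : R) (C : lmodType R).

Lemma spow_lim_eq (x y : spow_lim s C) :
  (forall i, sval x i = sval y i) -> x = y.
Proof.
case: x y => [x xP] [y yP] /= xy.
have {}xy : x = y by apply: functional_extensionality_dep.
by case: y / xy yP => yP; congr exist; exact: Prop_irrelevance.
Qed.

Lemma to_spow_lim_eq (c d : C) :
  to_spow_lim s c = to_spow_lim s d <->
  forall n, exists e, c - d = s ^+ n.+1 *: e.
Proof.
split=> [cd n|H]; last first.
  by apply: spow_lim_eq => n; apply/eqP/spow_quotP/H.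
apply/spow_quotP/eqP.
by have /(congr1 (fun x : spow_lim s C => sval x n)) := cd.
Qed.

Lemma s_separatedP :
  s_separated s C <->
  forall c : C, (forall n, exists e, c = s ^+ n.+1 *: e) -> c = 0.
Proof.
split=> [sep c H|H c d /to_spow_lim_eq cd].
  by apply/sep/to_spow_lim_eq => n; rewrite subr0.
by apply/eqP; rewrite -subr_eq0; apply/eqP/H.
Qed.

Lemma s_completeP :
  s_complete s C <->
  forall x : nat -> C,
    (forall i, exists e, x i.+1 - x i = s ^+ i.+1 *: e) ->
    exists c, forall i, exists e, c - x i = s ^+ i.+1 *: e.
Proof.
split=> [comp x xP|H y].
  have xP' i j : (i <= j)%N -> spow_trans i.+1 (\pi_(spow_quot s C j.+1) (x j))
      = \pi_(spow_quot s C i.+1) (x i).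
    move=> ij; rewrite spow_trans_pi //; apply/eqP/spow_quotP.
    (* Consecutive congruences add up: each later difference lies in a smaller [s^n C]. *)
    rewrite -(subnKC ij); elim: (j - i)%N => [|k [e eP]].
      by exists 0; rewrite addn0 subrr scaler0.
    have [f fP] := xP (i + k)%N; exists (s ^+ k *: f + e).
    by rewrite addnS scalerDr -eP scalerA -exprD addSn -fP addrA subrK.
  have [c cP] := comp (exist _ _ xP').
  exists c => i; apply/spow_quotP/eqP.
  by have /(congr1 (fun x : spow_lim s C => sval x i)) := cP.
pose x i := repr (sval y i).
have [|c cP] := H x.
  move=> i; apply/spow_quotP/eqP; rewrite /x reprK.
  exact: (svalP y i i.+1).
exists c; apply: spow_lim_eq => i /=.
by rewrite -[RHS]reprK; apply/eqP/spow_quotP/cP.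
Qed.

(** Elements of [R[s^-1]] are divisible by every power of [s], hence so are their images in [C]. *)
Lemma separated_hom_loc_eq0 : s_separated s C -> hom_eq0 (loc s) C.
Proof.
move=> /s_separatedP sep f x; apply: sep => n.
have [a [m ->]] := loc_fracE x.
exists (f (loc_frac s a (m + n.+1))); rewrite -linearZ /= scale_loc_frac.
by congr (f _); apply: loc_frac_eq; rewrite exprD mulrA.
Qed.

Lemma separated_complete_Ext1_loc_eq0 :
  s_separated s C -> s_complete s C -> Ext1_eq0 (loc s) C.
Proof.
move=> /s_separatedP sep /s_completeP comp; apply/Ext1_locP => a.
pose x n i := \sum_(k < i.+1) s ^+ k *: a (n + k)%N.
have x_lim n : exists c, forall i, exists e, c - x n i = s ^+ i.+1 *: e.
  apply: comp => i; exists (a (n + i.+1)%N).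
  by rewrite /x big_ord_recr /= addrAC subrr add0r.
pose b n := projT1 (cid (x_lim n)).
have bP n i : exists e, b n - x n i = s ^+ i.+1 *: e.
  exact: (projT2 (cid (x_lim n)) i).
exists b => n; apply/eqP; rewrite -subr_eq0; apply/eqP/sep => i.
(* Peeling off the first term of [x n i.+1] leaves [s *: x n.+1 i], so [b n] is approximated one
   level deeper than [b n.+1]. *)
have [e eP] := bP n i.+1; have [f fP] := bP n.+1 i.
exists (s *: e - s *: f).
have xS : x n i.+1 = a n + s *: x n.+1 i.
  rewrite /x big_ord_recl expr0 scale1r addn0 scaler_sumr; congr (_ + _).
  by apply: eq_bigr => k _; rewrite scalerA -exprS /= addSnnS.
rewrite scalerBr !scalerA -exprSr -eP exprS -scalerA -fP xS.
by rewrite scalerBr opprB opprD addrA (addrA (b n)) subrK addrAC.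
Qed.

Lemma torsion_free_expr n (c d : C) :
  s_torsion_free s C -> s ^+ n *: c = s ^+ n *: d -> c = d.
Proof.
move=> tf; elim: n => [|n IH]; first by rewrite !scale1r.
by rewrite exprS -!scalerA => /tf.
Qed.

Lemma torsion_free_hom_separated :
  s_torsion_free s C -> hom_eq0 (loc s) C -> s_separated s C.
Proof.
move=> tf hom0; apply/s_separatedP => d dP.
have dP' n : exists e, d = s ^+ n *: e.
  by case: n => [|n]; [exists d; rewrite scale1r|exact: dP].
(* [c n] plays the role of [d / s^n]; torsion-freeness makes it independent of the choice. *)
pose c n := projT1 (cid (dP' n)).
have cP n : s ^+ n *: c n = d by exact: esym (projT2 (cid (dP' n))).
pose f : loc s -> C := loc_lift (fun a n => a *: c n).
have fE a n : f (loc_frac s a n) = a *: c n.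
  apply: loc_liftE => {}a m b {}n k e.
  (* The factors [s ^+ m] and [s ^+ n] clear the denominators of [c m] and [c n]; [s ^+ k] makes the
     equality of fractions hold in [R]. *)
  apply: (@torsion_free_expr (k + n + m) _ _ tf).
  have E1 : s ^+ (k + n + m) *: (a *: c m) = (s ^+ k * (s ^+ n * a)) *: d.
    by rewrite -(cP m) !scalerA !exprD; congr (_ *: _); ring.
  have E2 : s ^+ (k + n + m) *: (b *: c n) = (s ^+ k * (s ^+ m * b)) *: d.
    by rewrite -(cP n) !scalerA !exprD; congr (_ *: _); ring.
  by rewrite E1 E2; congr (_ *: d); apply/eqP; rewrite -subr_eq0 -mulrBr e.
have f_lin : linear f.
  move=> r x y; have [a [m ->]] := loc_fracE x; have [b [n ->]] := loc_fracE y.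
  rewrite scale_loc_frac [_ + _]loc_addE !fE.
  apply: (@torsion_free_expr (m + n) _ _ tf).
  rewrite scalerA mulrC -scalerA cP scalerDr !scalerA exprD scalerDl.
  rewrite -{1}(cP m) -(cP n) !scalerA.
  by congr (_ *: _ + _ *: _); ring.
pose g : {linear loc s -> C} :=
  HB.pack f (GRing.isLinear.Build _ _ _ _ _ f_lin).
(* The zero morphism [g] sends [1] to [c 0], which is [d]. *)
by have := hom0 g (loc_frac s 1 0); rewrite /g /= fE scale1r -(cP 0%N) scale1r.
Qed.

Lemma Ext1_loc_complete : Ext1_eq0 (loc s) C -> s_complete s C.
Proof.
move=> /Ext1_locP H; apply/s_completeP => x xP.
pose a i := projT1 (cid (xP i)).
have aP i : x i.+1 - x i = s ^+ i.+1 *: a i by exact: (projT2 (cid (xP i))).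
have [b bP] := H a.
(* The error at level [i] is exactly [s ^+ i.+1 *: b i]: subtracting [s ^+ i.+1 *: a i] turns it
   into [s ^+ i.+2 *: b i.+1]. *)
exists (x 0%N + s *: b 0%N) => i; exists (b i).
elim: i => [|i IH]; first by rewrite addrAC subrr add0r.
apply: (addIr (x i.+1 - x i)).
by rewrite addrA subrK IH aP -bP scalerBr scalerA -exprSr addrC subrK.
Qed.

End Contramodule.

Theorem theorem2p4 (R : comPzRingType) (s : R) :
  (forall C : lmodType R,
     s_separated s C -> s_complete s C -> s_contramodule s C) /\
  (forall C : lmodType R,
     s_torsion_free s C -> s_contramodule s C ->
     s_separated s C /\ s_complete s C).
Proof.
split=> [C sep comp|C tf [hom0 ext0]]; split.
- exact: separated_hom_loc_eq0.
- exact: separated_complete_Ext1_loc_eq0.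
- exact: torsion_free_hom_separated.
- exact: Ext1_loc_complete.
Qed.
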